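(* Let $K\subset\mathbb{R}^2$ be a parallelogram that is neither a rectangle nor a rhombus, with side length ratio $r>1$ and larger interior angle $\theta\in(\frac{\pi}{2},\pi)$. Then $$\alpha_1(K)=\min\left\{r,\ \frac{r^2-2r\cos(\theta)+1}{\sqrt{(r^2+1)^2-4r^2\cos(\theta)^2}},\ \frac{r^2-2r\cos(\theta)-1}{\sqrt{(r^2-1)^2+4r^2\cos(\theta)^2}}\right\}.$$
   Context: Parallelograms are non-degenerate. The side length ratio of a parallelogram is the length of a longer edge divided by the length of a shorter edge. For an affine subspace $U\subset\mathbb{R}^2$, $P_U$ is the orthogonal projection onto $U$ and $\Phi_U(x)=2P_U(x)-x$ is the reflection across $U$. For convex bodies (compact convex sets with nonempty interior) $K,C\subset\mathbb{R}^2$, $R(K,C)=\inf\{\lambda>0 : K\subset z+\lambda C\text{ for some }z\in\mathbb{R}^2\}$. The first Minkowski chirality is $\alpha_1(K)=\inf\{R(K,\Phi_U(K)) : U\subset\mathbb{R}^2\text{ affine subspace},\ \dim U=1\}$. *)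

(* Defs.v *)
From HB Require Import structures.
From mathcomp Require Import all_boot all_order all_algebra.
From mathcomp Require Import all_classical all_reals all_analysis.

Set Implicit Arguments.
Unset Strict Implicit.
Unset Printing Implicit Defensive.

Import Order.TTheory GRing.Theory Num.Theory.

Local Open Scope classical_set_scope.
Local Open Scope ring_scope.

(* The library's norm on matrices is the sup norm, hence an explicit
   Euclidean structure. *)
Definition dot (R : realType) (n : nat) (x y : 'rV[R]_n) : R :=
  \sum_(i < n) x 0 i * y 0 i.

Definition enorm (R : realType) (n : nat) (x : 'rV[R]_n) : R :=
  Num.sqrt (dot x x).

Definition angle (R : realType) (n : nat) (x y : 'rV[R]_n) : R :=
  acos (dot x y / (enorm x * enorm y)).

Definition is_affine_subspace (R : realType) (n k : nat)
    (U : set 'rV[R]_n) : Prop :=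
  exists (a : 'rV[R]_n) (W : {vspace 'rV[R]_n}),
    \dim W = k /\ U = [set a + w | w in [set w | w \in W]].

(* For an affine subspace [U] exactly one [y] meets the condition; the default
   value 0 is only used for other sets. *)
Definition orth_proj (R : realType) (n : nat) (U : set 'rV[R]_n)
    (x : 'rV[R]_n) : 'rV[R]_n :=
  xget 0 [set y | U y /\ forall z, U z -> dot (x - y) (z - y) = 0].

Definition reflection (R : realType) (n : nat) (U : set 'rV[R]_n)
    (x : 'rV[R]_n) : 'rV[R]_n :=
  2 *: orth_proj U x - x.

(* [inf] is real-valued (0 on sets that are empty or unbounded below); for
   convex bodies the sets below are nonempty and bounded below by 0. *)
Definition circumratio (R : realType) (n : nat) (K C : set 'rV[R]_n) : R :=
  inf [set l : R | 0 < l /\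
    exists z : 'rV[R]_n, K `<=` [set z + l *: c | c in C]].

Definition alpha1 (R : realType) (K : set 'rV[R]_2) : R :=
  inf [set circumratio K (reflection U @` K) |
        U in [set U | is_affine_subspace 1 U]].

Definition parallelogram (R : realType) (p u v : 'rV[R]_2) : set 'rV[R]_2 :=
  [set x | exists s t : R,
    [/\ 0 <= s <= 1, 0 <= t <= 1 & x = p + s *: u + t *: v]].

Definition is_rectangle (R : realType) (K : set 'rV[R]_2) : Prop :=
  exists p u v : 'rV[R]_2,
    [/\ free [:: u; v], K = parallelogram p u v & dot u v = 0].

Definition is_rhombus (R : realType) (K : set 'rV[R]_2) : Prop :=
  exists p u v : 'rV[R]_2,
    [/\ free [:: u; v], K = parallelogram p u v & enorm u = enorm v].

Definition side_ratio (R : realType) (u v : 'rV[R]_2) : R :=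
  Num.max (enorm u) (enorm v) / Num.min (enorm u) (enorm v).

(* The interior angles of [parallelogram p u v] at [p] and [p + u] are
   [angle u v] and [angle (- u) v]; opposite angles are equal. *)
Definition larger_angle (R : realType) (u v : 'rV[R]_2) : R :=
  Num.max (angle u v) (angle (- u) v).

(* Main.v *)
(* The parallelogram K is contained in a translate of a multiple of its mirror
   image exactly when the linear part of the reflection maps the centred copy of
   K into that multiple of itself, so the circumratio is the operator norm of
   the linear part for the norm with unit ball K. As the axis rotates, this
   value runs over the values on the unit circle of a piecewise linear norm in
   the plane. By the triangle inequality, the minimum of such a norm over the
   circle is attained in the direction of a ray bounding one of its linearity
   cones; up to sign there are three such rays, one for each term of the
   minimum. *)
Require Import Defs.
From HB Require Import structures.
From mathcomp Require Import all_boot all_order all_algebra.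
From mathcomp Require Import all_classical all_reals all_analysis.
From mathcomp Require Import ring lra.

Set Implicit Arguments.
Unset Strict Implicit.
Unset Printing Implicit Defensive.

Import Order.TTheory GRing.Theory Num.Theory.

Local Open Scope classical_set_scope.
Local Open Scope ring_scope.

(** * Euclidean inner product and one-dimensional subspaces *)

Lemma dotC (R : realType) n (x y : 'rV[R]_n) : dot x y = dot y x.
Proof. by apply: eq_bigr => i _; rewrite mulrC. Qed.

Lemma dotDl (R : realType) n (x y z : 'rV[R]_n) :
  dot (x + y) z = dot x z + dot y z.
Proof. by rewrite -big_split; apply: eq_bigr => i _; rewrite mxE mulrDl. Qed.

Lemma dotZl (R : realType) n k (x y : 'rV[R]_n) : dot (k *: x) y = k * dot x y.
Proof. by rewrite mulr_sumr; apply: eq_bigr => i _; rewrite mxE mulrA. Qed.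

Lemma dotZr (R : realType) n k (x y : 'rV[R]_n) : dot x (k *: y) = k * dot x y.
Proof. by rewrite dotC dotZl dotC. Qed.

Lemma dotNl (R : realType) n (x y : 'rV[R]_n) : dot (- x) y = - dot x y.
Proof. by rewrite -scaleN1r dotZl mulN1r. Qed.

Lemma dot_eq0 (R : realType) n (x : 'rV[R]_n) : (dot x x == 0) = (x == 0).
Proof.
apply/idP/eqP => [|->]; last by rewrite /dot big1// => i _; rewrite mxE mul0r.
rewrite psumr_eq0 => [/allP x0|i _]; last by rewrite -expr2 sqr_ge0.
apply/rowP => i; rewrite mxE; apply/eqP.
by have /= := x0 i (mem_index_enum i); rewrite mulf_eq0 orbb.
Qed.

Lemma enormN (R : realType) n (x : 'rV[R]_n) : enorm (- x) = enorm x.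
Proof. by rewrite /enorm dotNl dotC dotNl opprK. Qed.

Lemma dim1_vline (F : fieldType) (vT : vectType F) (W : {vspace vT}) :
  \dim W = 1%N -> exists2 w, w != 0 & W = <[w]>%VS.
Proof.
move=> W1; have w0 : vpick W != 0.
  by rewrite vpick0; apply/eqP => W0; rewrite W0 dimv0 in W1.
exists (vpick W) => //; apply/eqP.
by rewrite eq_sym eqEdim -memvE memv_pick W1 dim_vline w0.
Qed.

(** * Reflections across lines *)

Definition affine_line (R : realType) n (a w : 'rV[R]_n) : set 'rV[R]_n :=
  [set a + x | x in [set x | x \in <[w]>%VS]].

Lemma affine_subspace1P (R : realType) n (U : set 'rV[R]_n) :
  is_affine_subspace 1 U <-> exists a, exists2 w, w != 0 & U = affine_line a w.
Proof.
split=> [[a [W [/dim1_vline[w w0 ->] ->]]]|[a [w w0 ->]]].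
  by exists a, w.
by exists a, <[w]>%VS; rewrite dim_vline w0.
Qed.

(** The linear part shared by the reflections across all lines of direction [w]. *)
Definition line_reflection (R : realType) n (w x : 'rV[R]_n) : 'rV[R]_n :=
  (2 * dot x w / dot w w) *: w - x.

Lemma orth_proj_line (R : realType) n (a w x : 'rV[R]_n) : w != 0 ->
  orth_proj (affine_line a w) x = a + (dot (x - a) w / dot w w) *: w.
Proof.
move=> w0; have ww0 : dot w w != 0 by rewrite dot_eq0.
have inl k : affine_line a w (a + k *: w).
  by exists (k *: w) => //=; apply/vlineP; exists k.
have dotk k l : dot (x - (a + k *: w)) (a + l *: w - (a + k *: w)) =
    (l - k) * (dot (x - a) w - k * dot w w).
  have -> : a + l *: w - (a + k *: w) = (l - k) *: w.
    by apply/rowP => i; rewrite !mxE; ring.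
  have -> : x - (a + k *: w) = (x - a) - k *: w by rewrite opprD addrA.
  by rewrite dotZr (dotDl (x - a)) dotNl dotZl.
apply: xget_unique; first split => // _ [_ /= /vlineP[l ->] <-].
  by rewrite dotk divfK // subrr mulr0.
move=> _ [[_ /= /vlineP[k ->] <-] orthk].
(* Orthogonality tested at parameter [k + 1] leaves the linear equation that determines [k]. *)
have := orthk _ (inl (k + 1)); rewrite dotk [k + 1]addrC addrK mul1r.
move=> /subr0_eq ->.
by rewrite mulfK.
Qed.

Lemma reflection_line (R : realType) n (a w x : 'rV[R]_n) : w != 0 ->
  reflection (affine_line a w) x = a + line_reflection w (x - a).
Proof.
move=> w0; rewrite /reflection orth_proj_line // /line_reflection.
apply/rowP => i; rewrite !mxE; ring.
Qed.

Lemma line_reflectionD (R : realType) n (w x y : 'rV[R]_n) :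
  line_reflection w (x + y) = line_reflection w x + line_reflection w y.
Proof. by rewrite /line_reflection dotDl; apply/rowP => i; rewrite !mxE; ring. Qed.

Lemma line_reflectionZ (R : realType) n k (w x : 'rV[R]_n) :
  line_reflection w (k *: x) = k *: line_reflection w x.
Proof. by rewrite /line_reflection dotZl; apply/rowP => i; rewrite !mxE; ring. Qed.

Lemma line_reflectionN (R : realType) n (w x : 'rV[R]_n) :
  line_reflection w (- x) = - line_reflection w x.
Proof. by rewrite -scaleN1r line_reflectionZ scaleN1r. Qed.

Lemma line_reflectionK (R : realType) n (w x : 'rV[R]_n) : w != 0 ->
  line_reflection w (line_reflection w x) = x.
Proof.
rewrite -dot_eq0 => ww0.
rewrite [LHS]/line_reflection dotDl dotNl dotZl.
by apply/rowP => i; rewrite !mxE; field.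
Qed.

(** * The circumratio as an operator norm *)

Lemma inf_ray (R : realType) (m : R) : inf [set l | m <= l] = m.
Proof.
have -> : [set l | m <= l] = [set` `[m, +oo[].
  by apply/seteqP; split=> l /=; rewrite in_itv /= andbT.
by rewrite inf_itv.
Qed.

Lemma free2_inj (F : fieldType) (vT : vectType F) (u v : vT) (a b a' b' : F) :
  free [:: u; v] -> a *: u + b *: v = a' *: u + b' *: v -> a = a' /\ b = b'.
Proof.
rewrite free_cons seq1_free span_seq1 => /andP[uv v0] e.
have e2 : (a - a') *: u = (b' - b) *: v.
  rewrite !scalerBl; apply/eqP; rewrite subr_eq addrAC eq_sym subr_eq addrC e.
  by rewrite addrC.
have aa : a = a'.
  apply/eqP; rewrite -subr_eq0; apply: contraNT uv => a0.
  apply/vlineP; exists ((a - a')^-1 * (b' - b)).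
  by rewrite -scalerA -e2 scalerK.
split => //; move: e2; rewrite aa subrr scale0r => /eqP.
by rewrite eq_sym scaler_eq0 (negbTE v0) orbF subr_eq0 => /eqP.
Qed.

(** A linear form on a square is largest at a vertex, so two sign patterns suffice. *)
Lemma normD_le (R : realDomainType) (x y l : R) :
  `|x + y| <= l -> `|x - y| <= l -> `|x| + `|y| <= l.
Proof.
rewrite !ler_norml => /andP[? ?] /andP[? ?].
by case: (ger0P x) => _; case: (ger0P y) => _; lra.
Qed.

Lemma normD2_le (R : realDomainType) (s t x y l : R) : `|s| <= 1 -> `|t| <= 1 ->
  `|x| + `|y| <= l -> `|s * x + t * y| <= l.
Proof.
move=> s1 t1 xy; apply: (le_trans (ler_normD _ _)); apply: le_trans xy.
by rewrite !normrM lerD // ler_piMl.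
Qed.

(* A parallelogram with edges [u], [v] is, up to translation, half the unit ball
   of the sup norm in the basis [(u, v)], so the circumratio is the operator
   norm of the reflection for this norm. *)
Lemma circumratio_reflection (R : realType) (p u v a w : 'rV[R]_2)
    (al be ga : R) :
    free [:: u; v] -> w != 0 ->
    line_reflection w u = al *: u + be *: v ->
    line_reflection w v = ga *: u - al *: v ->
  circumratio (parallelogram p u v)
    (reflection (affine_line a w) @` parallelogram p u v) =
  `|al| + Num.max `|be| `|ga|.
Proof.
move=> uv w0 Su Sv; set m := `|al| + _.
have S_comb s t : line_reflection w (s *: u + t *: v) =
    (s * al + t * ga) *: u + (s * be - t * al) *: v.
  rewrite line_reflectionD !line_reflectionZ Su Sv.
  by apply/rowP => i; rewrite !mxE; ring.
(* Otherwise the involution would send [u] to 0. Positivity makes the constraint [0 < l] automatic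
   on the ray from [m]. *)
have m_gt0 : 0 < m.
  rewrite lt_neqAle addr_ge0 ?le_max ?normr_ge0 // andbT eq_sym.
  apply/negP; rewrite paddr_eq0 ?le_max ?normr_ge0 // normr_eq0.
  case/andP => /eqP al0 /eqP max0.
  have be0 : be = 0.
    by apply/eqP; rewrite -normr_le0 -max0 le_max lexx.
  move: uv; rewrite free_cons span_seq1 => /andP[/negP uv _]; apply: uv.
  rewrite -(line_reflectionK u w0) Su al0 be0 !scale0r addr0.
  by rewrite -(scale0r 0) line_reflectionZ scale0r mem0v.
rewrite /circumratio -[RHS]inf_ray; congr inf; apply/seteqP; split=> l /=.
- move=> [l_gt0 [z sub]].
  (* Subtracting two memberships removes [z] and [a]. Applying the involution then puts the
     reflection on the left, and the right side has coordinates of modulus at most [l]. *)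
  have diff s t s' t' : 0 <= s <= 1 -> 0 <= t <= 1 -> 0 <= s' <= 1 ->
      0 <= t' <= 1 -> `|(s - s') * al + (t - t') * ga| <= l /\
                      `|(s - s') * be - (t - t') * al| <= l.
    move=> s01 t01 s'01 t'01.
    have [_ [k [x [y [x01 y01 ->]]] <-] e] : [set z + l *: c | c in
        reflection (affine_line a w) @` parallelogram p u v] (p + s *: u + t *: v).
      by apply: sub; exists s, t.
    have [_ [k' [x' [y' [x'01 y'01 ->]]] <-] e'] : [set z + l *: c | c in
        reflection (affine_line a w) @` parallelogram p u v] (p + s' *: u + t' *: v).
      by apply: sub; exists s', t'.
    have : (s - s') *: u + (t - t') *: v =
        l *: line_reflection w ((x - x') *: u + (y - y') *: v).
      have -> : (s - s') *: u + (t - t') *: v =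
          (p + s *: u + t *: v) - (p + s' *: u + t' *: v).
        by apply/rowP => i; rewrite !mxE; ring.
      have -> : (x - x') *: u + (y - y') *: v =
          (p + x *: u + y *: v - a) - (p + x' *: u + y' *: v - a).
        by apply/rowP => i; rewrite !mxE; ring.
      rewrite -e -e' !reflection_line //.
      move: (_ - a) (_ - a) => d d'; rewrite line_reflectionD line_reflectionN.
      by apply/rowP => i; rewrite !mxE; ring.
    move=> /(congr1 (line_reflection w)).
    rewrite line_reflectionZ line_reflectionK // S_comb scalerDr !scalerA.
    move=> /(free2_inj uv)[-> ->].
    by rewrite !normrM gtr0_norm // !ler_piMr ?(ltW l_gt0) // ler_norml; lra.
  have u01 : 0 <= (1 : R) <= 1 by rewrite ler01 lexx.
  have z01 : 0 <= (0 : R) <= 1 by rewrite lexx ler01.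
  (* The two diagonals of the parallelogram supply both sign patterns. *)
  have [] := diff 1 1 0 0 u01 u01 z01 z01.
  have [] := diff 1 0 0 1 u01 z01 z01 u01.
  rewrite !subr0 sub0r !mul1r !mulN1r opprK => h1 h2 h3 h4.
  have bl : `|be| + `|al| <= l by apply: normD_le.
  have gl : `|al| + `|ga| <= l by apply: normD_le.
  by rewrite /m maxEle; case: ifP => _ //; rewrite addrC.
- move=> ml; have l_gt0 : 0 < l by exact: lt_le_trans ml.
  have l0 : l != 0 by rewrite gt_eqF.
  split=> //; pose c := p + 2^-1 *: u + 2^-1 *: v.
  (* This translation brings the centre of the scaled mirror image to the centre [c]. *)
  exists (c - l *: (a + line_reflection w (c - a))) => _ [s [t [s01 t01 ->]]].
  have al_be : `|be| + `|al| <= l.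
    by apply: le_trans ml; rewrite addrC lerD2l le_max lexx.
  have al_ga : `|al| + `|ga| <= l.
    by apply: le_trans ml; rewrite lerD2l le_max lexx orbT.
  pose s2 := 2 * s - 1; pose t2 := 2 * t - 1.
  have s2_le : `|s2| <= 1 by rewrite ler_norml /s2; lra.
  have t2_le : `|t2| <= 1 by rewrite ler_norml /t2; lra.
  have xl : `|s2 * al + t2 * ga| <= l by exact: normD2_le.
  have yl : `|s2 * be + t2 * (- al)| <= l by apply: normD2_le; rewrite ?normrN.
  have half01 x : `|x| <= l -> 0 <= 2^-1 + x / (2 * l) <= 1.
    rewrite ler_norml => /andP[xl1 xl2].
    have : -1 <= x / l <= 1.
      by rewrite ler_pdivlMr // ler_pdivrMr // mulN1r mul1r xl1.
    have -> : x / (2 * l) = x / l / 2 by field.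
    lra.
  (* Coordinates of the preimage: the offset from [c] is reflected back and divided by [l]. *)
  pose x := 2^-1 + (s2 * al + t2 * ga) / (2 * l).
  pose y := 2^-1 + (s2 * be + t2 * (- al)) / (2 * l).
  exists (reflection (affine_line a w) (p + x *: u + y *: v)).
    by exists (p + x *: u + y *: v) => //; exists x, y; split=> //; exact: half01.
  rewrite reflection_line //.
  have -> : p + x *: u + y *: v - a =
      (c - a) + (2 * l)^-1 *: line_reflection w (s2 *: u + t2 *: v).
    by rewrite S_comb /c /x /y; apply/rowP => i; rewrite !mxE; field.
  rewrite (line_reflectionD w (c - a)) line_reflectionZ line_reflectionK //.
  move: (line_reflection w (c - a)) => q; rewrite /c /s2 /t2.
  by apply/rowP => i; rewrite !mxE; field.
Qed.

(** * Minimum of the piecewise linear gauge on the unit circle *)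

(* The circumratio for a reflection, where [r] is the side ratio, [c] and [s]
   the cosine and sine of the larger angle, and [(x, y)] the cosine and sine of
   twice the angle between the axis and a bisector of the edge directions. *)
Definition gauge (R : realType) (r c s x y : R) : R :=
  (`|y| + Num.max (r * `|s * x + c * y|) (`|s * x - c * y| / r)) / s.

Definition chirality_value (R : realType) (r c : R) : R :=
  Num.min r
    (Num.min
      ((r ^+ 2 - 2 * r * c + 1) /
        Num.sqrt ((r ^+ 2 + 1) ^+ 2 - 4 * r ^+ 2 * c ^+ 2))
      ((r ^+ 2 - 2 * r * c - 1) /
        Num.sqrt ((r ^+ 2 - 1) ^+ 2 + 4 * r ^+ 2 * c ^+ 2))).

Lemma gaugeN (R : realType) (r c s x y : R) :
  gauge r c s (- x) (- y) = gauge r c s x y.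
Proof.
rewrite /gauge normrN.
have -> : s * - x + c * - y = - (s * x + c * y) by ring.
have -> : s * - x - c * - y = - (s * x - c * y) by ring.
by rewrite !normrN.
Qed.

(** Let a norm be linear on the cone of two vectors of lengths [d1], [d2], with values [n1], [n2]
    there. The triangle inequality gives [1 <= a * d1 + b * d2] for a unit vector of the cone;
    multiplying by [m] yields the bound. *)
Lemma ge_cone (R : realType) (m x1 y1 x2 y2 d1 d2 n1 n2 a b : R) :
    0 <= m -> 0 <= a -> 0 <= b -> 0 <= d1 -> 0 <= d2 ->
    d1 ^+ 2 = x1 ^+ 2 + y1 ^+ 2 -> d2 ^+ 2 = x2 ^+ 2 + y2 ^+ 2 ->
    m * d1 <= n1 -> m * d2 <= n2 ->
    (a * x1 + b * x2) ^+ 2 + (a * y1 + b * y2) ^+ 2 = 1 ->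
  m <= a * n1 + b * n2.
Proof.
move=> m0 a0 b0 d10 d20 e1 e2 n1m n2m e.
(* Cauchy-Schwarz, proved by squaring when the left side is nonnegative. *)
have cs : x1 * x2 + y1 * y2 <= d1 * d2.
  have [neg|pos] := ltP (x1 * x2 + y1 * y2) 0.
    by apply: le_trans (mulr_ge0 d10 d20); exact: ltW.
  rewrite -ler_sqr ?nnegrE ?mulr_ge0 // exprMn e1 e2.
  have := sqr_ge0 (x1 * y2 - x2 * y1); nra.
have : 1 <= a * d1 + b * d2.
  rewrite -ler_sqr ?nnegrE ?addr_ge0 ?mulr_ge0 // expr1n -e.
  have -> : (a * d1 + b * d2) ^+ 2 =
      a ^+ 2 * d1 ^+ 2 + b ^+ 2 * d2 ^+ 2 + 2 * (a * b) * (d1 * d2) by ring.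
  rewrite e1 e2.
  have := ler_wpM2l (mulr_ge0 a0 b0) cs; lra.
move=> /(ler_wpM2l m0).
have := ler_wpM2l a0 n1m; have := ler_wpM2l b0 n2m; lra.
Qed.

Section Gauge.
Variables (R : realType) (r c s : R).
Hypotheses (r1 : 1 < r) (c_lt0 : c < 0) (s_gt0 : 0 < s).
Hypothesis cs1 : s ^+ 2 + c ^+ 2 = 1.

(** The denominators [dA] and [dB] are the lengths of the vectors A and B that bound the linearity
    cones, by [dA2] and [dB2]. *)
Let dA := Num.sqrt ((r ^+ 2 - 1) ^+ 2 + 4 * r ^+ 2 * c ^+ 2).
Let dB := Num.sqrt ((r ^+ 2 + 1) ^+ 2 - 4 * r ^+ 2 * c ^+ 2).

Let r_gt0 : 0 < r. Proof. exact: lt_trans r1. Qed.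
Let r2_gt1 : 1 < r ^+ 2. Proof. by rewrite exprn_egt1 ?ltW. Qed.
Let rc_lt0 : r * c < 0. Proof. by rewrite pmulr_rlt0. Qed.
Let cs_lt0 : c * s < 0. Proof. by rewrite pmulr_llt0. Qed.
Let s2E : s ^+ 2 = 1 - c ^+ 2. Proof. by rewrite -cs1 addrK. Qed.

Let dA2 : dA ^+ 2 = (- ((r ^+ 2 + 1) * c)) ^+ 2 + ((r ^+ 2 - 1) * s) ^+ 2.
Proof.
rewrite sqr_sqrtr; first by rewrite !exprMn s2E; ring.
have := sqr_ge0 (r ^+ 2 - 1); have := sqr_ge0 (r * c); nra.
Qed.

Let dB2 : dB ^+ 2 = (- ((r ^+ 2 - 1) * c)) ^+ 2 + ((r ^+ 2 + 1) * s) ^+ 2.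
Proof.
have e : (r ^+ 2 + 1) ^+ 2 - 4 * r ^+ 2 * c ^+ 2 =
    (- ((r ^+ 2 - 1) * c)) ^+ 2 + ((r ^+ 2 + 1) * s) ^+ 2.
  by rewrite [(_ * s) ^+ 2]exprMn s2E; ring.
by rewrite sqr_sqrtr e // addr_ge0 ?sqr_ge0.
Qed.

Let dA_gt0 : 0 < dA.
Proof.
rewrite sqrtr_gt0; have := sqr_ge0 (r * c).
have : 0 < (r ^+ 2 - 1) ^+ 2 by rewrite exprn_gt0 // subr_gt0.
nra.
Qed.

Let dB_gt0 : 0 < dB.
Proof.
rewrite lt_neqAle sqrtr_ge0 andbT eq_sym -sqrf_eq0 dB2 gt_eqF //.
apply: ltr_wpDl; first exact: sqr_ge0.
by rewrite exprn_gt0 // mulr_gt0 // addr_gt0 // exprn_gt0.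
Qed.

(* The gauge is piecewise linear; in the upper half plane its linearity cones
   are bounded by (1, 0), A = (-(r^2+1)c, (r^2-1)s), B = (-(r^2-1)c, (r^2+1)s)
   and (-1, 0). *)
Lemma gauge_ge x y : x ^+ 2 + y ^+ 2 = 1 ->
  chirality_value r c <= gauge r c s x y.
Proof.
wlog y0 : x y / 0 <= y => [hw|] xy1.
  have [|/ltW yn] := leP 0 y; first by move=> /hw; exact.
  by rewrite -gaugeN; apply: hw; rewrite ?oppr_ge0 ?sqrrN.
set m := chirality_value r c.
have m0 : 0 <= m.
  rewrite /m /chirality_value !le_min !divr_ge0 ?sqrtr_ge0 ?(ltW r_gt0) //.
    by have := r2_gt1; have := rc_lt0; lra.
  by have := r2_gt1; have := rc_lt0; lra.
(* The right sides of [mr], [mA], [mB] are the gauge values at the unit vectors (1, 0) and (-1, 0),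
   at A and at B. *)
have mr : m * 1 <= r by rewrite mulr1 /m /chirality_value ge_min lexx.
have mA : m * dA <= r ^+ 2 - 2 * r * c - 1.
  by rewrite -ler_pdivlMr // /m /chirality_value !ge_min lexx !orbT.
have mB : m * dB <= r ^+ 2 - 2 * r * c + 1.
  by rewrite -ler_pdivlMr // /m /chirality_value !ge_min lexx !orbT.
have d1 : 1 ^+ 2 = 1 ^+ 2 + 0 ^+ 2 :> R by rewrite expr0n addr0.
have d1N : 1 ^+ 2 = (- 1) ^+ 2 + 0 ^+ 2 :> R by rewrite sqrrN expr0n addr0.
have r0 : r != 0 by rewrite gt_eqF.
have s0 : s != 0 by rewrite gt_eqF.
have c0 : c != 0 by rewrite lt_eqF.
have r2m_gt0 : 0 < r ^+ 2 - 1 by rewrite subr_gt0.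
have r2p_gt0 : 0 < r ^+ 2 + 1 by apply: addr_gt0 => //; exact: exprn_gt0.
have r2m0 : r ^+ 2 - 1 != 0 by rewrite gt_eqF.
have r2p0 : r ^+ 2 + 1 != 0 by rewrite gt_eqF.
(* A lower bound needs only one branch of the maximum, the one active on the cone at hand. *)
have gauge_bound l : l <= r * `|s * x + c * y| \/ l <= `|s * x - c * y| / r ->
    (y + l) / s <= gauge r c s x y.
  move=> hl; rewrite /gauge ler_pM2r ?invr_gt0 // (ger0_norm y0) lerD2l le_max.
  by apply/orP.
(* Cone of (1, 0) and A: the tested number is the coefficient of (1, 0). *)
have [a0|a0] := leP 0 (x + y * (r ^+ 2 + 1) * c / ((r ^+ 2 - 1) * s)).
  apply: (@le_trans _ _ ((y + r * (s * x + c * y)) / s)); last first.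
    by apply: gauge_bound; left; rewrite ler_pM2l // ler_norm.
  have b0 : 0 <= y / ((r ^+ 2 - 1) * s) by rewrite divr_ge0 // mulr_ge0 // ltW.
  have := ge_cone m0 a0 b0 ler01 (ltW dA_gt0) d1 dA2 mr mA.
  set lhs := (X in X = 1 -> _).
  have -> : lhs = x ^+ 2 + y ^+ 2 by rewrite /lhs; field; rewrite s0.
  move=> /(_ xy1) /le_trans; apply.
  rewrite le_eqVlt; apply/orP; left; apply/eqP.
  by field; rewrite s0.
(* Cone of (-1, 0) and B: the tested number is the coefficient of (-1, 0). *)
have [a'0|a'0] := leP 0 (- (x + y * (r ^+ 2 - 1) * c / ((r ^+ 2 + 1) * s))).
  apply: (@le_trans _ _ ((y + r * - (s * x + c * y)) / s)); last first.
    by apply: gauge_bound; left; rewrite ler_pM2l // -normrN ler_norm.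
  have b0 : 0 <= y / ((r ^+ 2 + 1) * s) by rewrite divr_ge0 // mulr_ge0 // ltW.
  have := ge_cone m0 a'0 b0 ler01 (ltW dB_gt0) d1N dB2 mr mB.
  set lhs := (X in X = 1 -> _).
  have -> : lhs = x ^+ 2 + y ^+ 2 by rewrite /lhs; field; rewrite s0.
  move=> /(_ xy1) /le_trans; apply.
  rewrite le_eqVlt; apply/orP; left; apply/eqP.
  by field; rewrite s0.
apply: (@le_trans _ _ ((y + (s * x - c * y) / r) / s)); last first.
  by apply: gauge_bound; right; rewrite ler_pM2r ?invr_gt0 // ler_norm.
(* Cone of A and B: this is their determinant, and [a1], [b1] concern the coefficients given by
   Cramer's rule. *)
have D_gt0 : 0 < - (4 * r ^+ 2 * (c * s)).
  by rewrite -mulrN mulr_gt0 ?oppr_gt0 // mulr_gt0 // exprn_gt0.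
have a1 : 0 <= (x * (r ^+ 2 + 1) * s + y * (r ^+ 2 - 1) * c) /
    - (4 * r ^+ 2 * (c * s)).
  have e : x * (r ^+ 2 + 1) * s + y * (r ^+ 2 - 1) * c =
      - - (x + y * (r ^+ 2 - 1) * c / ((r ^+ 2 + 1) * s)) * ((r ^+ 2 + 1) * s).
    by field; rewrite s0.
  rewrite divr_ge0 ?(ltW D_gt0) // e mulr_ge0 ?oppr_ge0 ?(ltW a'0) //.
  by rewrite mulr_ge0 // ltW.
have b1 : 0 <= - (y * (r ^+ 2 + 1) * c + x * (r ^+ 2 - 1) * s) /
    - (4 * r ^+ 2 * (c * s)).
  have e : - (y * (r ^+ 2 + 1) * c + x * (r ^+ 2 - 1) * s) =
      - (x + y * (r ^+ 2 + 1) * c / ((r ^+ 2 - 1) * s)) * ((r ^+ 2 - 1) * s).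
    by field; rewrite s0.
  rewrite divr_ge0 ?(ltW D_gt0) // e mulr_ge0 ?oppr_ge0 ?(ltW a0) //.
  by rewrite mulr_ge0 // ltW.
have := ge_cone m0 a1 b1 (ltW dA_gt0) (ltW dB_gt0) dA2 dB2 mA mB.
set lhs := (X in X = 1 -> _).
have -> : lhs = x ^+ 2 + y ^+ 2 by rewrite /lhs; field; rewrite ?r0 ?s0 ?c0.
move=> /(_ xy1) /le_trans; apply.
rewrite le_eqVlt; apply/orP; left; apply/eqP.
by field; rewrite ?r0 ?s0 ?c0.
Qed.

(** The three terms are the gauge values at (1, 0), B / [dB] and A / [dA]; the smallest one decides
    the witness. *)
Lemma gauge_attained :
  exists x y, x ^+ 2 + y ^+ 2 = 1 /\ gauge r c s x y = chirality_value r c.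
Proof.
have r0 : r != 0 by rewrite gt_eqF.
have s0 : s != 0 by rewrite gt_eqF.
have dA0 : dA != 0 by rewrite gt_eqF.
have dB0 : dB != 0 by rewrite gt_eqF.
have ratio : r^-1 < r by apply: lt_trans r1; rewrite invf_lt1.
(* On the rays of A and B the two branches of the maximum coincide. *)
have max_eq t : Num.max (r * t) (r ^+ 2 * t / r) = r * t.
  by have -> : r ^+ 2 * t / r = r * t; [by field | rewrite maxxx].
rewrite /chirality_value -/dA -/dB minEle; case: ifP => _.
  exists 1, 0; split; first by rewrite expr1n expr0n addr0.
  rewrite /gauge normr0 !mulr0 addr0 subr0 mulr1 add0r (gtr0_norm s_gt0).
  by rewrite max_l ?mulfK // mulrC ler_pM2r // ltW.
rewrite minEle; case: ifP => _.
  exists (- ((r ^+ 2 - 1) * c) / dB), ((r ^+ 2 + 1) * s / dB); split.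
    by rewrite !expr_div_n -mulrDl -dB2 divff // expf_neq0.
  pose t := - (2 * (c * s)) / dB.
  have t0 : 0 < t by rewrite divr_gt0 // oppr_gt0 pmulr_rlt0.
  rewrite /gauge.
  have -> : s * (- ((r ^+ 2 - 1) * c) / dB) + c * ((r ^+ 2 + 1) * s / dB) = - t.
    by rewrite /t; field.
  have -> : s * (- ((r ^+ 2 - 1) * c) / dB) - c * ((r ^+ 2 + 1) * s / dB) =
      r ^+ 2 * t by rewrite /t; field.
  have y0 : 0 < (r ^+ 2 + 1) * s / dB.
    by rewrite divr_gt0 // mulr_gt0 // addr_gt0 // exprn_gt0.
  rewrite normrN (gtr0_norm t0) (gtr0_norm y0) normrM (gtr0_norm t0).
  rewrite ger0_norm ?sqr_ge0 //.
  by rewrite max_eq /t; field; rewrite s0 dB0.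
exists (- ((r ^+ 2 + 1) * c) / dA), ((r ^+ 2 - 1) * s / dA); split.
  by rewrite !expr_div_n -mulrDl -dA2 divff // expf_neq0.
pose t := - (2 * (c * s)) / dA.
have t0 : 0 < t by rewrite divr_gt0 // oppr_gt0 pmulr_rlt0.
rewrite /gauge.
have -> : s * (- ((r ^+ 2 + 1) * c) / dA) + c * ((r ^+ 2 - 1) * s / dA) = t.
  by rewrite /t; field.
have -> : s * (- ((r ^+ 2 + 1) * c) / dA) - c * ((r ^+ 2 - 1) * s / dA) =
    r ^+ 2 * t by rewrite /t; field.
have y0 : 0 < (r ^+ 2 - 1) * s / dA by rewrite divr_gt0 // mulr_gt0 // subr_gt0.
rewrite (gtr0_norm t0) (gtr0_norm y0) normrM (gtr0_norm t0).
rewrite ger0_norm ?sqr_ge0 //.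
by rewrite max_eq /t; field; rewrite s0 dA0.
Qed.

End Gauge.

(** * Coordinates and determinants in the plane *)

Lemma inf_min (R : realType) (E : set R) (m : R) :
  E m -> lbound E m -> inf E = m.
Proof.
move=> Em mE; apply/eqP; rewrite eq_le lb_le_inf ?ge_inf //; last by exists m.
by exists m.
Qed.

Lemma row2P (R : Type) (x y : 'rV[R]_2) :
  x 0 0 = y 0 0 -> x 0 1 = y 0 1 -> x = y.
Proof.
move=> e0 e1; apply/rowP => i.
have [->//|->//] : i = 0 \/ i = 1.
by case: i => -[|[|[]]] // ?; [left|right]; exact: val_inj.
Qed.

Lemma dot2E (R : realType) (x y : 'rV[R]_2) :
  dot x y = x 0 0 * y 0 0 + x 0 1 * y 0 1.
Proof.
rewrite /dot big_ord_recl big_ord1; congr (_ + x 0 _ * y 0 _); exact: val_inj.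
Qed.

Definition det2 (R : realType) (x y : 'rV[R]_2) : R :=
  x 0 0 * y 0 1 - x 0 1 * y 0 0.

Lemma lagrange2 (R : realType) (x y : 'rV[R]_2) :
  dot x y ^+ 2 + det2 x y ^+ 2 = dot x x * dot y y.
Proof. by rewrite !dot2E /det2; ring. Qed.

(** If the determinant vanished, [u] would equal its orthogonal projection onto the span of [v]. *)
Lemma free_det2 (R : realType) (u v : 'rV[R]_2) :
  free [:: u; v] -> det2 u v != 0.
Proof.
rewrite free_cons seq1_free span_seq1 => /andP[uv v0].
apply: contraNneq uv => D0.
have vv0 : dot v v != 0 by rewrite dot_eq0.
apply/vlineP; exists (dot u v / dot v v).
move: vv0 D0; rewrite !dot2E /det2 => vv0 /subr0_eq D0.
apply: row2P; rewrite !mxE; apply: (mulIf vv0); rewrite mulrAC divfK //.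
  by rewrite mulrDl mulrDr !mulrA; ring: D0.
by ring: D0.
Qed.

Lemma enorm_gt0 (R : realType) n (x : 'rV[R]_n) : x != 0 -> 0 < enorm x.
Proof.
rewrite -dot_eq0 => x0; rewrite sqrtr_gt0 lt_neqAle eq_sym x0.
by apply: sumr_ge0 => i _; rewrite -expr2 sqr_ge0.
Qed.

Lemma sqr_enorm (R : realType) n (x : 'rV[R]_n) : enorm x ^+ 2 = dot x x.
Proof. by rewrite sqr_sqrtr //; apply: sumr_ge0 => i _; rewrite -expr2 sqr_ge0. Qed.

(** * From axes of reflection to points of the unit circle *)

Section Link.
Variables (R : realType) (p u v : 'rV[R]_2).
Hypothesis uv : free [:: u; v].

Let u0 : u != 0. Proof. by rewrite (free_not0 uv) // mem_head. Qed.
Let v0 : v != 0. Proof. by rewrite (free_not0 uv) // !inE eqxx orbT. Qed.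
Let D0 : det2 u v != 0. Proof. exact: free_det2. Qed.
Let A_gt0 : 0 < enorm u. Proof. exact: enorm_gt0. Qed.
Let B_gt0 : 0 < enorm v. Proof. exact: enorm_gt0. Qed.
Let A0 : enorm u != 0. Proof. by rewrite gt_eqF. Qed.
Let B0 : enorm v != 0. Proof. by rewrite gt_eqF. Qed.

Let r := enorm u / enorm v.
Let c := dot u v / (enorm u * enorm v).
(** The absolute value keeps the sine positive for either orientation; the orientation survives as
    [Num.sg (det2 u v)] in the first gauge argument. *)
Let s := `|det2 u v| / (enorm u * enorm v).
(** With vectors read as complex numbers, [g] and [h] are the real and imaginary parts of the
    product of [u] and [v], whose argument is twice that of a bisector. *)
Let g := u 0 0 * v 0 0 - u 0 1 * v 0 1.
Let h := u 0 0 * v 0 1 + u 0 1 * v 0 0.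

Let s_gt0 : 0 < s. Proof. by rewrite divr_gt0 ?normr_gt0 // mulr_gt0. Qed.

Let cs1 : s ^+ 2 + c ^+ 2 = 1.
Proof.
rewrite !expr_div_n real_normK ?num_real // -mulrDl addrC lagrange2 exprMn.
by rewrite !sqr_enorm divff // mulf_neq0 // dot_eq0.
Qed.

Let gh : g ^+ 2 + h ^+ 2 = (enorm u * enorm v) ^+ 2.
Proof. by rewrite exprMn !sqr_enorm !dot2E /g /h; ring. Qed.

(* [(X, Y)] is the first row of the matrix [[X, Y], [Y, -X]] of the reflection;
   the numbers [al], [be], [ga] come from Cramer's rule. *)
Lemma circumratio_gauge (a w : 'rV[R]_2) (X Y : R) : w != 0 ->
    w 0 0 ^+ 2 - w 0 1 ^+ 2 = X * dot w w -> 2 * w 0 0 * w 0 1 = Y * dot w w ->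
  circumratio (parallelogram p u v)
    (reflection (affine_line a w) @` parallelogram p u v) =
  gauge r c s (- (Num.sg (det2 u v) * (X * g + Y * h)) / (enorm u * enorm v))
    ((X * h - Y * g) / (enorm u * enorm v)).
Proof.
move=> w0 eX eY.
have ww0 : dot w w != 0 by rewrite dot_eq0.
have D0' := D0; have A0' := A0; have B0' := B0.
have SE x : (line_reflection w x 0 0 = X * x 0 0 + Y * x 0 1) *
            (line_reflection w x 0 1 = Y * x 0 0 - X * x 0 1).
  have -> : X = (w 0 0 ^+ 2 - w 0 1 ^+ 2) / dot w w by rewrite eX mulfK.
  have -> : Y = 2 * w 0 0 * w 0 1 / dot w w by rewrite eY mulfK.
  by move: ww0; rewrite /line_reflection !mxE !dot2E => ww0; split; field.
pose al := (X * h - Y * g) / det2 u v.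
pose be := (Y * (u 0 0 ^+ 2 - u 0 1 ^+ 2) - 2 * X * u 0 0 * u 0 1) / det2 u v.
pose ga := (2 * X * v 0 0 * v 0 1 + Y * (v 0 1 ^+ 2 - v 0 0 ^+ 2)) / det2 u v.
rewrite (@circumratio_reflection _ p u v a w al be ga) //; first last.
- apply: row2P; rewrite !(SE, mxE) /al /ga /g /h; move: D0'; rewrite /det2 => D0'.
    by field.
  by field.
- apply: row2P; rewrite !(SE, mxE) /al /be /g /h; move: D0'; rewrite /det2 => D0'.
    by field.
  by field.
set x := - _ / _; set y := _ / _.
have nD : `|det2 u v| = Num.sg (det2 u v) * det2 u v by exact: normrEsg.
have sg2 : Num.sg (det2 u v) ^+ 2 = 1 by rewrite sqr_sg D0.
have n0 : `|det2 u v| != 0 by rewrite normr_eq0.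
have sx : s * x = - (det2 u v * (X * g + Y * h)) / (enorm u * enorm v) ^+ 2.
  rewrite /s /x nD; transitivity (Num.sg (det2 u v) ^+ 2 *
     (- (det2 u v * (X * g + Y * h)) / (enorm u * enorm v) ^+ 2)).
    by field; rewrite A0' B0'.
  by rewrite sg2 mul1r.
(* With [e2], this matches the branches of the gauge with [be] and [ga]. The factor [enorm v ^+ 2]
   is inserted so that, once expanded, both sides agree as polynomials. *)
have e1 : s * x + c * y = - (be * det2 u v) / enorm u ^+ 2.
  rewrite sx /c /y /be divfK //.
  transitivity
    (- (enorm v ^+ 2 * (Y * (u 0 0 ^+ 2 - u 0 1 ^+ 2) - 2 * X * u 0 0 * u 0 1)) /
      (enorm u * enorm v) ^+ 2); last first.
    by field; rewrite A0' B0'.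
  rewrite sqr_enorm !dot2E /det2 /g /h.
  by field; rewrite A0' B0'.
have e2 : s * x - c * y = - (ga * det2 u v) / enorm v ^+ 2.
  rewrite sx /c /y /ga divfK //.
  transitivity
    (- (enorm u ^+ 2 * (2 * X * v 0 0 * v 0 1 + Y * (v 0 1 ^+ 2 - v 0 0 ^+ 2))) /
      (enorm u * enorm v) ^+ 2); last first.
    by field; rewrite A0' B0'.
  rewrite sqr_enorm !dot2E /det2 /g /h.
  by field; rewrite A0' B0'.
rewrite /gauge e1 e2 !normrM !normfV !normrX !normrN !normrM !normfV.
rewrite (gtr0_norm A_gt0) (gtr0_norm B_gt0) /r /s.
rewrite [RHS]mulrDl maxr_pMl; last by rewrite invr_ge0 ltW.
congr (_ + Num.max _ _).
- by field; rewrite A0' B0' n0.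
- by field; rewrite A0' B0' n0.
- by field; rewrite A0' B0' n0.
Qed.

(** Lines correspond to points of the unit circle in both directions, so the infimum is the minimum
    of the gauge. *)
Lemma alpha1_parallelogram : dot u v < 0 -> enorm v < enorm u ->
  alpha1 (parallelogram p u v) = chirality_value r c.
Proof.
move=> uv_lt0 vu.
have AB_gt0 : 0 < enorm u * enorm v by rewrite mulr_gt0.
have r1 : 1 < r by rewrite /r ltr_pdivlMr // mul1r.
have c_lt0 : c < 0 by rewrite /c pmulr_llt0 // invr_gt0.
apply: inf_min.
  have [x [y [xy1 <-]]] := gauge_attained r1 c_lt0 s_gt0 cs1.
  have A0' := A0; have B0' := B0.
  pose x' := - Num.sg (det2 u v) * x.
  have xy1' : x' ^+ 2 + y ^+ 2 = 1.
    by rewrite /x' exprMn sqrrN sqr_sg D0 mul1r.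
  (* The passage from [(X, Y)] to the gauge arguments is, up to the sign in [x'], a reflection of
     the plane, hence inverted by the same formula. *)
  pose X := (x' * g + y * h) / (enorm u * enorm v).
  pose Y := (x' * h - y * g) / (enorm u * enorm v).
  have XY1 : X ^+ 2 + Y ^+ 2 = 1.
    rewrite /X /Y !expr_div_n -mulrDl.
    have -> : (x' * g + y * h) ^+ 2 + (x' * h - y * g) ^+ 2 =
       (x' ^+ 2 + y ^+ 2) * (g ^+ 2 + h ^+ 2) by ring.
    by rewrite xy1' mul1r gh divff // expf_neq0 // mulf_neq0.
  (* An axis at half the angle of [(X, Y)]: direction (1 + X, Y), which degenerates at X = -1, where
     the vertical axis serves. *)
  have [w [w0 wX wY]] : exists w : 'rV[R]_2, [/\ w != 0,
      w 0 0 ^+ 2 - w 0 1 ^+ 2 = X * dot w w & 2 * w 0 0 * w 0 1 = Y * dot w w].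
    have [X1|X1] := eqVneq X (-1).
      have Y0 : Y = 0.
        by apply/eqP; rewrite -sqrf_eq0; apply/eqP; move: XY1; rewrite X1; lra.
      exists (\row_i (i == 1)%:R); rewrite dot2E !mxE X1 Y0 /=; split; try by ring.
      by apply/eqP => /rowP/(_ 1)/eqP; rewrite !mxE eqxx oner_eq0.
    exists (\row_i (if i == 0 then 1 + X else Y)); rewrite dot2E !mxE /=.
    have Y2 : Y ^+ 2 = 1 - X ^+ 2 by rewrite -XY1; ring.
    split.
    - apply/eqP => /rowP/(_ 0)/eqP.
      by rewrite !mxE eqxx addrC addr_eq0; apply/negP.
    - by rewrite -!expr2 Y2; ring.
    - by rewrite -!expr2 Y2; ring.
  exists (affine_line 0 w); first by apply/affine_subspace1P; exists 0, w.
  rewrite (circumratio_gauge _ w0 wX wY); congr (gauge r c s _ _).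
    have -> : X * g + Y * h = x' * (enorm u * enorm v).
      have -> : X * g + Y * h = x' * (g ^+ 2 + h ^+ 2) / (enorm u * enorm v).
        by rewrite /X /Y; field; rewrite A0' B0'.
      by rewrite gh; field; rewrite A0' B0'.
    rewrite mulrA -mulNr mulfK ?gt_eqF // /x' mulNr mulrN opprK mulrA -expr2.
    by rewrite sqr_sg D0 mul1r.
  have -> : X * h - Y * g = y * (g ^+ 2 + h ^+ 2) / (enorm u * enorm v).
    by rewrite /X /Y; field; rewrite A0' B0'.
  by rewrite gh; field; rewrite A0' B0'.
move=> _ [_ /affine_subspace1P[a [w w0 ->]] <-].
have ww0 : dot w w != 0 by rewrite dot_eq0.
pose X := (w 0 0 ^+ 2 - w 0 1 ^+ 2) / dot w w.
pose Y := 2 * w 0 0 * w 0 1 / dot w w.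
have XY1 : X ^+ 2 + Y ^+ 2 = 1.
  by move: ww0; rewrite /X /Y dot2E => ww0; field.
rewrite (@circumratio_gauge a w X Y) ?divfK //.
apply: gauge_ge => //; rewrite !expr_div_n -mulrDl sqrrN exprMn sqr_sg D0 mul1r.
have -> : (X * g + Y * h) ^+ 2 + (X * h - Y * g) ^+ 2 =
   (X ^+ 2 + Y ^+ 2) * (g ^+ 2 + h ^+ 2) by ring.
by rewrite XY1 mul1r gh divff // expf_neq0 // gt_eqF.
Qed.
End Link.

(** * Choice of base vertex and edge order, and conclusion *)

Lemma parallelogramC (R : realType) (p u v : 'rV[R]_2) :
  parallelogram p u v = parallelogram p v u.
Proof.
by apply/seteqP; split=> x [s [t [s01 t01 ->]]]; exists t, s; rewrite addrAC.
Qed.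

(** Moving the base to the adjacent vertex exchanges the two interior angles, so the angle at the
    base may be taken obtuse. *)
Lemma parallelogramN (R : realType) (p u v : 'rV[R]_2) :
  parallelogram p u v = parallelogram (p + u) (- u) v.
Proof.
apply/seteqP; split=> x [s [t [s01 t01 ->]]]; exists (1 - s), t.
all: by split=> //; [lra | apply/rowP => i; rewrite !mxE; ring].
Qed.

(** Cauchy-Schwarz, read off [lagrange2], puts the quotient in the domain where [cos] inverts
    [acos]. *)
Lemma cos_angle (R : realType) (x y : 'rV[R]_2) : x != 0 -> y != 0 ->
  cos (angle x y) = dot x y / (enorm x * enorm y).
Proof.
move=> x0 y0; have xy : 0 < enorm x * enorm y by rewrite mulr_gt0 ?enorm_gt0.
rewrite acosK // in_itv /= -ler_norml normrM normfV (gtr0_norm xy).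
rewrite ler_pdivrMr // mul1r -ler_sqr ?nnegrE ?(ltW xy) //.
by rewrite real_normK ?num_real // exprMn !sqr_enorm -lagrange2 lerDl sqr_ge0.
Qed.

(** Swapping the edges puts the longer one first; equal lengths contradict a side ratio above 1. *)
Lemma alpha1_obtuse (R : realType) (p u v : 'rV[R]_2) : free [:: u; v] ->
    1 < side_ratio u v -> dot u v < 0 ->
  alpha1 (parallelogram p u v) =
  chirality_value (side_ratio u v) (dot u v / (enorm u * enorm v)).
Proof.
move=> uv; rewrite /side_ratio.
have [uv_lt|vu_lt|uv_eq] := ltgtP (enorm u) (enorm v) => r1 uv0.
- rewrite parallelogramC dotC [enorm u * _]mulrC.
  apply: alpha1_parallelogram => //; last by rewrite dotC.
  by rewrite -(perm_free (permEl (perm_catC [:: u] [:: v]))).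
- exact: alpha1_parallelogram.
- have v0 : v != 0 by rewrite (free_not0 uv) // !inE eqxx orbT.
  by move: r1; rewrite uv_eq divff ?ltxx // gt_eqF // enorm_gt0.
Qed.

Lemma cos_lt0_pihalf (R : realType) (x : R) : pi / 2 < x < pi -> cos x < 0.
Proof.
move=> /andP[x1 x2]; rewrite -oppr_gt0 -sinBpihalf sin_gt0_pi //.
rewrite subr_gt0 x1 /=; have := pi_gt0 R; lra.
Qed.

Theorem corollary5p4 (R : realType) (K : set 'rV[R]_2) (p u v : 'rV[R]_2)
    (r theta : R)
    (huv : free [:: u; v])
    (hK : K = parallelogram p u v)
    (hrect : ~ is_rectangle K)
    (hrhomb : ~ is_rhombus K)
    (hr : r = side_ratio u v)
    (hr1 : 1 < r)
    (htheta : theta = larger_angle u v)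
    (htheta_lt : pi / 2 < theta < pi) :
  alpha1 K =
    Num.min r
      (Num.min
        ((r ^+ 2 - 2 * r * cos theta + 1) /
          Num.sqrt ((r ^+ 2 + 1) ^+ 2 - 4 * r ^+ 2 * cos theta ^+ 2))
        ((r ^+ 2 - 2 * r * cos theta - 1) /
          Num.sqrt ((r ^+ 2 - 1) ^+ 2 + 4 * r ^+ 2 * cos theta ^+ 2))).
Proof.
have cos_lt0 := cos_lt0_pihalf htheta_lt.
have u0 : u != 0 by rewrite (free_not0 huv) // mem_head.
have v0 : v != 0 by rewrite (free_not0 huv) // !inE eqxx orbT.
have AB_gt0 : 0 < enorm u * enorm v by rewrite mulr_gt0 ?enorm_gt0.
rewrite -[RHS]/(chirality_value r (cos theta)) hK hr.
(* If the larger angle lies at [p + u], the parallelogram is rebased there. *)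
move: cos_lt0; rewrite htheta /larger_angle maxElt; case: ifP => _.
  rewrite cos_angle ?oppr_eq0 // enormN pmulr_llt0 ?invr_gt0 // => uv_lt0.
  have r1 : 1 < side_ratio (- u) v.
    by rewrite /side_ratio enormN -/(side_ratio u v) -hr.
  rewrite parallelogramN alpha1_obtuse //; first by rewrite /side_ratio enormN.
  move: huv; rewrite !free_cons !span_seq1 => /andP[uv ->]; rewrite andbT.
  by rewrite memvN.
rewrite cos_angle // pmulr_llt0 ?invr_gt0 // => uv_lt0.
by rewrite alpha1_obtuse // -hr.
Qed.
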